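(* Let $\pi$ be a foliated bivector field on a smooth manifold $M$. Then for every function $\phi\in C^\infty(M)$, the bivector field $\phi\pi$ is foliated. In particular, conformally Poisson structures are foliated bivector fields.
   Context: For a bivector field $\pi$ on $M$, $\pi^\#:T^*M\to TM$ is defined by $\langle \pi^\#(\xi),\eta\rangle=\langle \pi,\xi\wedge\eta\rangle$. $\pi$ is foliated if $\pi^\#(\Omega^1(M))$ is an integrable distribution, i.e. $[\pi^\#(\Omega^1(M)),\pi^\#(\Omega^1(M))]\subset\pi^\#(\Omega^1(M))$. A bivector field is Poisson if $[\pi,\pi]=0$ (Schouten–Nijenhuis bracket). A bivector field is a conformally Poisson structure if it can be written as $\phi\pi'$ with $\phi\in C^\infty(M)$ and $\pi'$ a Poisson structure. *)

(* Defs.v *)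
From HB Require Import structures.
From mathcomp Require Import all_boot all_order all_algebra.
From mathcomp Require Import all_classical all_reals all_analysis.
From mathcomp Require Import ring.
Set Implicit Arguments.
Unset Strict Implicit.
Unset Printing Implicit Defensive.
Import Order.TTheory GRing.Theory Num.Theory.
Import numFieldNormedType.Exports.
Local Open Scope classical_set_scope.
Local Open Scope ring_scope.

(** * Smooth maps on open subsets of normed spaces *)

(** Meant for open [U]: [f] is total, its values off [U] are irrelevant. *)
Fixpoint Ck_on (R : realType) (V W : normedModType R) (k : nat)
    (U : set V) (f : V -> W) : Prop :=
  match k with
  | 0%N => forall x, U x -> {for x, continuous f}
  | k'.+1 => (forall x, U x -> differentiable f x) /\
             (forall v : V, Ck_on k' U (fun x => 'D_v f x))
  end.

Definition smooth_on (R : realType) (V W : normedModType R)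
    (U : set V) (f : V -> W) : Prop :=
  forall k, Ck_on k U f.

(** * Smooth manifolds (Hausdorff, second countable, of dimension [n]) *)

(** The charts are indexed by [atlas]; [coord c] and [param c] are total
    functions that are mutually inverse homeomorphisms between the open sets
    [chart_dom c] and [coord c @` chart_dom c].  Row vectors are used for
    R^n because ['d f x v = v *m jacobian f x] in this library. *)
Record smooth_manifold (R : realType) (n : nat) := SmoothManifold {
  carrier :> topologicalType;
  manifold_hausdorff : hausdorff_space carrier;
  manifold_second_countable : @second_countable carrier;
  atlas : Type;
  chart_dom : atlas -> set carrier;
  coord : atlas -> carrier -> 'rV[R]_n;
  param : atlas -> 'rV[R]_n -> carrier;
  chart_dom_open : forall c, open (chart_dom c);
  chart_img_open : forall c, open (coord c @` chart_dom c);
  chart_cover : forall p : carrier, exists c, chart_dom c p;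
  coordK : forall c p, chart_dom c p -> param c (coord c p) = p;
  coord_continuous : forall c, {within chart_dom c, continuous (coord c)};
  param_continuous :
    forall c, {within coord c @` chart_dom c, continuous (param c)};
  transition_smooth : forall c d : atlas,
    smooth_on (coord c @` (chart_dom c `&` chart_dom d))
              (coord d \o param c)
}.

Section Fields.
Context (R : realType) (n : nat) (M : smooth_manifold R n).
Implicit Types c d : atlas M.
Implicit Types x : 'rV[R]_n.

Definition chart_img c : set 'rV[R]_n := coord c @` chart_dom c.

Definition overlap c d : set 'rV[R]_n :=
  coord c @` (chart_dom c `&` chart_dom d).

Definition transition c d : 'rV[R]_n -> 'rV[R]_n := coord d \o param c.

Definition smooth_function (phi : M -> R) : Prop :=
  forall c, smooth_on (chart_img c) (phi \o param c : 'rV[R]_n -> R^o).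

(** Sections of TM, T*M and /\^2 TM are given by their components in every
    chart of the atlas, subject to the change-of-coordinates rule of the
    bundle.  [F c x] is meaningful for [x] in [chart_img c] only, whence the
    equality [field_eq].  Components of vectors are rows and components of
    covectors are columns; a bivector has the antisymmetric matrix
    (pi^{ij}) with pi = 1/2 \sum_{i,j} pi^{ij} d_i /\ d_j. *)
Definition local_field (T : Type) := atlas M -> 'rV[R]_n -> T.

Definition field_eq (T : Type) (F G : local_field T) : Prop :=
  forall c x, chart_img c x -> F c x = G c x.

Definition vector_field (X : local_field 'rV[R]_n) : Prop :=
  (forall c, smooth_on (chart_img c) (X c)) /\
  (forall c d x, overlap c d x ->
     X d (transition c d x) = X c x *m jacobian (transition c d) x).

Definition one_form (xi : local_field 'cV[R]_n) : Prop :=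
  (forall c, smooth_on (chart_img c) (xi c)) /\
  (forall c d x, overlap c d x ->
     xi c x = jacobian (transition c d) x *m xi d (transition c d x)).

Definition bivector_field (pi : local_field 'M[R]_n) : Prop :=
  [/\ forall c, smooth_on (chart_img c) (pi c),
      forall c x, chart_img c x -> (pi c x)^T = - pi c x &
      forall c d x, overlap c d x ->
        pi d (transition c d x) =
        (jacobian (transition c d) x)^T *m pi c x *m
          jacobian (transition c d) x].

Definition scale_bivector (phi : M -> R) (pi : local_field 'M[R]_n) :
    local_field 'M[R]_n :=
  fun c x => phi (param c x) *: pi c x.

(** [<X, eta>] and [<pi, xi /\ eta>], the latter normalized by
    [<X /\ Y, xi /\ eta> = <X, xi> <Y, eta> - <X, eta> <Y, xi>]. *)
Definition pairing1 (X : local_field 'rV[R]_n) (eta : local_field 'cV[R]_n) :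
    local_field R :=
  fun c x => (X c x *m eta c x) 0 0.

Definition pairing2 (pi : local_field 'M[R]_n)
    (xi eta : local_field 'cV[R]_n) : local_field R :=
  fun c x => \sum_(i < n) \sum_(j < n) pi c x i j * xi c x i 0 * eta c x j 0.

Definition sharp (pi : local_field 'M[R]_n) (xi : local_field 'cV[R]_n) :
    local_field 'rV[R]_n :=
  fun c x => (xi c x)^T *m pi c x.

Lemma sharpP pi xi eta : pairing1 (sharp pi xi) eta = pairing2 pi xi eta.
Proof.
apply/funext => c; apply/funext => x; rewrite /pairing1 /pairing2 /sharp mxE.
rewrite exchange_big; apply: eq_bigr => j _ /=; rewrite mxE mulr_suml.
by apply: eq_bigr => i _; rewrite mxE [xi c x i 0 * _]mulrC.
Qed.

Definition lie_bracket (X Y : local_field 'rV[R]_n) : local_field 'rV[R]_n :=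
  fun c x => 'D_(X c x) (Y c) x - 'D_(Y c x) (X c) x.

Definition sharp_image (pi : local_field 'M[R]_n) :
    set (local_field 'rV[R]_n) :=
  [set X | exists2 xi, one_form xi & field_eq X (sharp pi xi)].

Definition foliated (pi : local_field 'M[R]_n) : Prop :=
  bivector_field pi /\
  forall X Y, sharp_image pi X -> sharp_image pi Y ->
    sharp_image pi (lie_bracket X Y).

(** [partial f i x] is the i-th partial derivative of [f] at [x]. *)
Definition partial (f : 'rV[R]_n -> R) (i : 'I_n) x : R :=
  'D_(delta_mx 0 i) (f : 'rV[R]_n -> R^o) x.

(** Components [P, Q]^{ijk} of the Schouten-Nijenhuis bracket of two bivector
    fields, the biadditive extension of
      [X /\ Y, Z /\ W] = [X, Z] /\ Y /\ W - [X, W] /\ Y /\ Z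
                         - [Y, Z] /\ X /\ W + [Y, W] /\ X /\ Z
    (see [schouten_wedge]). *)
Definition schouten (P Q : local_field 'M[R]_n) :
    local_field ('I_n -> 'I_n -> 'I_n -> R) :=
  fun c x i j k =>
    let T (a b e : 'I_n) := \sum_(l < n)
      (P c x a l * partial (fun y => Q c y b e) l x +
       Q c x a l * partial (fun y => P c y b e) l x) in
    T i j k + T j k i + T k i j.

Definition poisson (pi : local_field 'M[R]_n) : Prop :=
  bivector_field pi /\
  field_eq (schouten pi pi) (fun _ _ _ _ _ => 0).

Definition conformally_poisson (pi : local_field 'M[R]_n) : Prop :=
  bivector_field pi /\
  exists phi pi', [/\ smooth_function phi, poisson pi' &
                      field_eq pi (scale_bivector phi pi')].

Definition wedge (X Y : local_field 'rV[R]_n) : local_field 'M[R]_n :=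
  fun c x => (X c x)^T *m Y c x - (Y c x)^T *m X c x.

Definition wedge3 (X Y Z : local_field 'rV[R]_n) :
    local_field ('I_n -> 'I_n -> 'I_n -> R) :=
  fun c x i j k =>
    let t (a b e : 'I_n) := X c x 0 a * Y c x 0 b * Z c x 0 e in
    t i j k + t j k i + t k i j - t i k j - t j i k - t k j i.

Lemma wedgeE X Y c x i j :
  wedge X Y c x i j = X c x 0 i * Y c x 0 j - Y c x 0 i * X c x 0 j.
Proof. by rewrite !mxE !big_ord1 !mxE. Qed.

Lemma lie_bracketE (X Y : local_field 'rV[R]_n) c x i :
  differentiable (X c) x -> differentiable (Y c) x ->
  lie_bracket X Y c x 0 i =
  \sum_(l < n) (X c x 0 l * partial (fun y => Y c y 0 i) l x -
                Y c x 0 l * partial (fun y => X c y 0 i) l x).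
Proof.
have D (F : 'rV[R]_n -> 'rV[R]_n) (v : 'rV[R]_n) : differentiable F x ->
    ('D_v F x) 0 i =
    \sum_(l < n) v 0 l * partial (fun y => F y 0 i) l x.
  move=> dF; rewrite deriveE // {1}(row_sum_delta v) linear_sum summxE.
  apply: eq_bigr => l _; rewrite linearZ mxE /partial; congr (_ * _).
  have dl : derivable F x (delta_mx 0 l) by exact: diff_derivable.
  by rewrite -deriveE // derive_mx // mxE.
by move=> dX dY; rewrite !mxE !D // sumrB.
Qed.

Lemma wedge3_suml (X Y Z : local_field 'rV[R]_n) c x
    (u : 'I_n -> 'I_n -> R) i j k :
  (forall a, X c x 0 a = \sum_(l < n) u l a) ->
  wedge3 X Y Z c x i j k =
  \sum_(l < n)
    let t (a b e : 'I_n) := u l a * Y c x 0 b * Z c x 0 e in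
    (t i j k + t j k i + t k i j - t i k j - t j i k - t k j i).
Proof.
by move=> Xu; rewrite /wedge3 !Xu !mulr_suml -!big_split -!sumrB.
Qed.

Lemma partial_wedge (X Y : local_field 'rV[R]_n) c x i j l :
  differentiable (X c) x -> differentiable (Y c) x ->
  partial (fun y => wedge X Y c y i j) l x =
  X c x 0 i * partial (fun y => Y c y 0 j) l x +
  partial (fun y => X c y 0 i) l x * Y c x 0 j -
  (Y c x 0 i * partial (fun y => X c y 0 j) l x +
   partial (fun y => Y c y 0 i) l x * X c x 0 j).
Proof.
have Dc (F : 'rV[R]_n -> 'rV[R]_n) a : differentiable F x ->
    derivable (fun y => F y 0 a : R^o) x (delta_mx 0 l).
  by move=> dF; exact: (derivable_mxP _ _ _).1 (diff_derivable dF) 0 a.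
move=> dX dY; rewrite /partial.
pose f a y : R := X c y 0 a; pose g a y : R := Y c y 0 a.
have df a : derivable (f a) x (delta_mx 0 l) by exact: Dc.
have dg a : derivable (g a) x (delta_mx 0 l) by exact: Dc.
have -> : (fun y => wedge X Y c y i j) = f i * g j - g i * f j.
  by apply/funext => y; rewrite wedgeE.
rewrite deriveB; [|exact: derivableM|exact: derivableM].
rewrite (deriveM (df i) (dg j)) (deriveM (dg i) (df j)) -/(f i) -/(g i).
rewrite -!/(partial _ _ _) /f /g /GRing.scale /=.
do 4!move: (partial _ l x) => ?.
by move: (X c x 0 i) (X c x 0 j) (Y c x 0 i) (Y c x 0 j) => *; ring.
Qed.

Lemma schouten_wedge (X Y Z W : local_field 'rV[R]_n) c x :
  differentiable (X c) x -> differentiable (Y c) x ->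
  differentiable (Z c) x -> differentiable (W c) x ->
  forall i j k,
  schouten (wedge X Y) (wedge Z W) c x i j k =
  wedge3 (lie_bracket X Z) Y W c x i j k
  - wedge3 (lie_bracket X W) Y Z c x i j k
  - wedge3 (lie_bracket Y Z) X W c x i j k
  + wedge3 (lie_bracket Y W) X Z c x i j k.
Proof.
move=> dX dY dZ dW i j k; rewrite /schouten.
have E (A B C D : local_field 'rV[R]_n) (dA : differentiable (A c) x)
    (dB : differentiable (B c) x) :=
  wedge3_suml C D i j k (fun a => lie_bracketE a dA dB).
have subst4 (a b e f a' b' e' f' : R) : a = a' -> b = b' -> e = e' ->
  f = f' -> a - b - e + f = a' - b' - e' + f' by move=> -> -> -> ->.
apply: etrans (esym (subst4 _ _ _ _ _ _ _ _ (E X Z Y W dX dZ)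
  (E X W Y Z dX dW) (E Y Z X W dY dZ) (E Y W X Z dY dW))) => {E subst4}.
rewrite -!sumrB -!big_split; apply: eq_bigr => l _ /=.
rewrite !partial_wedge// !wedgeE.
do 12!move: (partial _ l x) => ?.
move: (X c x 0 i) (X c x 0 j) (X c x 0 k) (X c x 0 l) => ????.
move: (Y c x 0 i) (Y c x 0 j) (Y c x 0 k) (Y c x 0 l) => ????.
move: (Z c x 0 i) (Z c x 0 j) (Z c x 0 k) (Z c x 0 l) => ????.
move: (W c x 0 i) (W c x 0 j) (W c x 0 k) (W c x 0 l) => ????.
by ring.
Qed.

End Fields.

(* Main.v *)
Require Import Defs.
From HB Require Import structures.
From mathcomp Require Import all_boot all_order all_algebra.
From mathcomp Require Import all_classical all_reals all_analysis.
From mathcomp Require Import ring.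
Set Implicit Arguments.
Unset Strict Implicit.
Unset Printing Implicit Defensive.
Import Order.TTheory GRing.Theory Num.Theory.
Import numFieldNormedType.Exports.
Local Open Scope classical_set_scope.
Local Open Scope ring_scope.

(** Write A = pi#(xi) and B = pi#(eta).

    If pi is foliated, so that [A, B] = pi#(zeta), then
    (phi pi)#(xi) = phi A and (phi pi)#(eta) = phi B, and the Leibniz rule
    gives
      [phi A, phi B] = phi (phi [A, B] + A(phi) B - B(phi) A)
                     = (phi pi)#(phi zeta + A(phi) eta - B(phi) xi).
    The last argument is a smooth one-form, so phi pi is foliated
    ([lie_bracket_scale], [foliatedZ]).

    If pi is Poisson, then [A, B] = pi#([xi, eta]_pi) for the Koszul bracket
      [xi, eta]_pi = i_A d eta - i_B d xi + d(pi(xi, eta)),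
    hence pi is foliated; multiplying by phi, so is every conformally Poisson
    structure.  In coordinates the identity is algebraic: expand both sides by
    the product rule, and what remains is the vanishing of [pi, pi]
    ([koszul_algebra], [sharp_koszul_bracket]).

    Since fields are families of components in charts, one has to check that
    [xi, eta]_pi obeys the change-of-coordinates rule of one-forms.  The formula
    above is chosen because each of its terms is natural by itself: pairings
    and interior products transform correctly by matrix algebra, differentials
    by the chain rule, and d eta because the second derivatives of the
    transition maps are symmetric
    ([covariant_two_tensor_exterior_derivative]).  That symmetry is Schwarz's
    theorem, [derive_comm], proved by applying the mean value theorem twice to
    a second difference. *)

(** * Calculus of C^k maps *)

(** The difference [g - f] vanishes near [x], hence has differential 0 there. *)
Lemma near_eq_differentiable (R : realType) (V W : normedModType R)
    (f g : V -> W) (x : V) :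
  (\near x, f x = g x) -> differentiable f x -> differentiable g x.
Proof.
move=> fg df.
have -> : g = f + (g - f) by rewrite addrC subrK.
apply: differentiableD df _.
have h0 : (\near x, (g - f) x = 0).
  by apply: filterS fg => y fgy; rewrite -[LHS]/(g y - f y) fgy subrr.
have E : (g - f) \o shift x = cst ((g - f) x) + (\0 : {linear V -> W}) +o_ 0 id.
  apply/eqaddoP => e e0.
  rewrite (nbhs_singleton h0).
  have : \forall y \near 0, (g - f) (y + x) = 0.
    by move: h0; rewrite (near_shift 0)/= subr0.
  apply: filterS => y /= h.
  rewrite -[X in `|X|]/((g - f) (y + x) - (0 + 0)) h.
  by rewrite addr0 subrr normr0 mulr_ge0// ltW.
have c0 : continuous (\0 : {linear V -> W}) by exact: cst_continuous.
by apply/diff_locallyP; rewrite (diff_unique c0 E).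
Qed.

Section CkOn.
Context (R : realType) (V : normedModType R).
Implicit Types (W : normedModType R) (U : set V) (k : nat).

Lemma open_near_eq (T : Type) U (f g : V -> T) x : open U -> U x ->
  (forall y, U y -> f y = g y) -> \near x, f x = g x.
Proof.
move=> oU Ux fg; apply: (filterS fg); exact: open_nbhs_nbhs.
Qed.

Lemma derive_open_ext W U (f g : V -> W) v x : open U -> U x ->
  (forall y, U y -> f y = g y) -> 'D_v f x = 'D_v g x.
Proof. by move=> oU Ux fg; apply: near_eq_derive; exact: open_near_eq fg. Qed.

Lemma Ck_on_ext W U k (f g : V -> W) : open U ->
  (forall x, U x -> f x = g x) -> Ck_on k U f -> Ck_on k U g.
Proof.
move=> oU; elim: k f g => [|k IH] f g fg /=.
  move=> cf x Ux; have nfg : \near x, f x = g x by exact: open_near_eq fg.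
  rewrite /prop_for /continuous_at -(nbhs_singleton nfg).
  by apply: cvg_trans (cf x Ux); exact: near_eq_cvg.
move=> [df Df]; split=> [x Ux|v].
  by apply: near_eq_differentiable (df x Ux); exact: open_near_eq fg.
by apply: IH (Df v) => x Ux; exact: derive_open_ext fg.
Qed.

Lemma Ck_onW W U k (f : V -> W) : Ck_on k.+1 U f -> Ck_on k U f.
Proof.
elim: k f => [|k IH] f [df Df].
  by move=> x Ux; exact: differentiable_continuous (df x Ux).
by split=> // v; exact: IH (Df v).
Qed.

Lemma Ck_on_cst W U k (w : W) : Ck_on k U (cst w).
Proof.
elim: k w => [|k IH] w /=; first by move=> x _; exact: cst_continuous.
split=> [x _|v]; first exact: differentiable_cst.
have -> : (fun x => 'D_v (cst w) x) = cst 0.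
  by apply/funext => x; rewrite derive_cst.
exact: IH.
Qed.

Lemma Ck_onD W U k (f g : V -> W) : open U ->
  Ck_on k U f -> Ck_on k U g -> Ck_on k U (fun x => f x + g x).
Proof.
move=> oU; elim: k f g => [|k IH] f g.
  by move=> cf cg x Ux; apply: cvgD; [exact: cf|exact: cg].
move=> [df Df] [dg Dg]; split=> [x Ux|v].
  by apply: differentiableD; [exact: df|exact: dg].
apply: Ck_on_ext (IH _ _ (Df v) (Dg v)) => // x Ux.
by rewrite -deriveD//; apply: diff_derivable; [exact: df|exact: dg].
Qed.

Lemma Ck_on_linear W W' U k (L : {linear W -> W'}) (f : V -> W) : open U ->
  continuous L -> Ck_on k U f -> Ck_on k U (fun x => L (f x)).
Proof.
move=> oU cL; elim: k f => [|k IH] f.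
  by move=> cf x Ux; apply: cvg_comp (cf x Ux) _; exact: cL.
move=> [df Df]; have dL y : differentiable L y by exact: linear_differentiable.
split=> [x Ux|v].
  by apply: (differentiable_comp (df x Ux)); exact: dL.
apply: Ck_on_ext (IH _ (Df v)) => // x Ux.
have dfx := df x Ux; have dLf := differentiable_comp dfx (dL (f x)).
by rewrite [RHS](deriveE v dLf) (diff_comp dfx (dL (f x)))/= diff_lin// deriveE.
Qed.

Lemma Ck_onM U k (f g : V -> R^o) : open U ->
  Ck_on k U f -> Ck_on k U g -> Ck_on k U (fun x => f x * g x : R^o).
Proof.
move=> oU; elim: k f g => [|k IH] f g.
  by move=> cf cg x Ux; apply: cvgM; [exact: cf|exact: cg].
move=> Cf Cg; have [df Df] := Cf; have [dg Dg] := Cg; split=> [x Ux|v].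
  by apply: differentiableM; [exact: df|exact: dg].
have C1 := IH _ _ (Ck_onW Cf) (Dg v); have C2 := IH _ _ (Ck_onW Cg) (Df v).
apply: Ck_on_ext (Ck_onD oU C1 C2) => // x Ux.
by rewrite [RHS]deriveM//; apply: diff_derivable; [exact: df|exact: dg].
Qed.

End CkOn.

(** * Symmetry of second derivatives *)

Section Schwarz.
Context (R : realType) (V : normedModType R).

(** Restricting to the line [r |-> a + r *: u] reduces directional derivatives
    to derivatives in one variable, to which the mean value theorem applies. *)
Lemma is_derive_line (f : V -> R^o) (a u : V) (s : R) :
  differentiable f (a + s *: u) ->
  is_derive s 1 (fun r : R => f (a + r *: u) : R) ('D_u f (a + s *: u)).
Proof.
move=> df; have := diff_derivable (v := u) df.
have E : (fun h : R => h^-1 *: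
      ((f \o shift (a + s *: u)) (h *: u) - f (a + s *: u))) =
  (fun h : R => h^-1 *: (((fun r : R => f (a + r *: u)) \o shift s) (h *: 1)
     - f (a + s *: u))).
  apply/funext => h /=; congr (_ *: (f _ - _)).
  by rewrite [h *: 1]mulr1 scalerDl addrCA.
move=> d; split; first by move: d; rewrite /derivable E.
by rewrite /derive E.
Qed.

Lemma derive_translate (f : V -> R^o) (u w x : V) :
  'D_u (fun y => f (y + w)) x = 'D_u f (x + w).
Proof. by rewrite /derive; under eq_fun do rewrite /= -addrA. Qed.

Lemma MVT_line (f : V -> R^o) (a u : V) (t : R) : 0 <= t ->
  (forall s, 0 <= s <= t -> differentiable f (a + s *: u)) ->
  exists2 s, 0 <= s <= t & f (a + t *: u) - f a = 'D_u f (a + s *: u) * t.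
Proof.
move=> t0 df.
pose h : R -> R := fun r => f (a + r *: u).
pose dh : R -> R := fun s => 'D_u f (a + s *: u).
have D (s : R) : s \in `[0, t]%R -> is_derive s 1 h (dh s).
  by rewrite in_itv/= => st; apply: is_derive_line; exact: df.
have Doo (s : R) : s \in `]0, t[%R -> is_derive s 1 h (dh s).
  by move=> /subset_itv_oo_cc/D.
have ch : {within `[0, t], continuous h}.
  by apply: derivable_within_continuous => s /D[].
have [s] := MVT_segment t0 Doo ch.
rewrite in_itv/= subr0 => st E; exists s => //.
by rewrite -[RHS]E /h scale0r addr0.
Qed.

(** With [g y = f (y + t *: v) - f y], the left-hand side is
    [g (a + t *: u) - g a]; the mean value theorem applies to [g] along [u],
    then to ['D_u f] along [v]. *)
Lemma second_difference U (f : V -> R^o) (a u v : V) (t : R) : open U ->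
  Ck_on 2 U f -> 0 <= t ->
  (forall r s, 0 <= r <= t -> 0 <= s <= t -> U (a + r *: u + s *: v)) ->
  exists r s, [/\ 0 <= r <= t, 0 <= s <= t &
    f (a + t *: u + t *: v) - f (a + t *: u) - f (a + t *: v) + f a =
    'D_v (fun x => 'D_u f x) (a + r *: u + s *: v) * t ^+ 2].
Proof.
move=> oU [df /(_ u)[dDf _]] t0 Ut.
have tt : 0 <= t <= t by rewrite t0 lexx.
have zt : 0 <= (0 : R) <= t by rewrite lexx t0.
pose f' : V -> R^o := fun y => f (y + t *: v).
pose g : V -> R^o := f' - f.
have df' x : U (x + t *: v) -> differentiable f' x.
  have dsh : differentiable (fun y : V => y + t *: v) x.
    exact: differentiableD.
  by move=> /df d; exact: (differentiable_comp dsh d).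
have Ua r : 0 <= r <= t -> U (a + r *: u).
  by move=> rt; have := Ut r 0 rt zt; rewrite scale0r addr0.
have dg r : 0 <= r <= t -> differentiable g (a + r *: u).
  move=> rt; apply: differentiableB; last by apply/df/Ua.
  by apply: df'; apply: Ut.
have [r rt Er] := MVT_line t0 dg.
have dDu s : 0 <= s <= t ->
    differentiable (fun x => 'D_u f x) (a + r *: u + s *: v).
  by move=> st; apply: dDf; exact: Ut.
have [s st Es] : exists2 s, 0 <= s <= t & 'D_u f (a + r *: u + t *: v) -
    'D_u f (a + r *: u) = 'D_v (fun x => 'D_u f x) (a + r *: u + s *: v) * t.
  exact: MVT_line t0 dDu.
exists r, s; split=> //.
rewrite expr2 mulrA -Es.
have -> : 'D_u f (a + r *: u + t *: v) - 'D_u f (a + r *: u) =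
    'D_u g (a + r *: u).
  have d1 := diff_derivable (v := u) (df' _ (Ut r t rt tt)).
  have d2 := diff_derivable (v := u) (df _ (Ua r rt)).
  by rewrite /g (deriveB d1 d2) derive_translate.
rewrite -Er -[g (a + t *: u)]/(f (a + t *: u + t *: v) - f (a + t *: u)).
rewrite -[g a]/(f (a + t *: v) - f a).
by rewrite opprB addrA [in RHS]addrAC.
Qed.

(** Schwarz's theorem.  The second difference of [f] over the parallelogram of
    sides [t *: u] and [t *: v] is symmetric in [u] and [v]; divided by [t ^+ 2]
    it is a value of either mixed derivative near [x], and both are
    continuous at [x]. *)
Theorem derive_comm U (f : V -> R^o) (u v x : V) : open U ->
  Ck_on 2 U f -> U x ->
  'D_v (fun y => 'D_u f y) x = 'D_u (fun y => 'D_v f y) x.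
Proof.
move=> oU Cf Ux.
have cont w z : {for x, continuous (fun y => 'D_z (fun y => 'D_w f y) y)}.
  by have [_ /(_ w)[_ /(_ z)]] := Cf; exact.
pose A y : R := 'D_v (fun y => 'D_u f y) y.
pose B y : R := 'D_u (fun y => 'D_v f y) y.
rewrite -/(A x) -/(B x).
have cA : continuous_at x A by exact: cont.
have cB : continuous_at x B by exact: cont.
have sdA (t : R) (t0 : 0 <= t)
    (Ut : forall r s, 0 <= r <= t -> 0 <= s <= t -> U (x + r *: u + s *: v)) :
    exists r s, [/\ 0 <= r <= t, 0 <= s <= t &
      f (x + t *: u + t *: v) - f (x + t *: u) - f (x + t *: v) + f x =
      A (x + r *: u + s *: v) * t ^+ 2].
  exact: second_difference oU Cf t0 Ut.
have sdB (t : R) (t0 : 0 <= t)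
    (Ut : forall r s, 0 <= r <= t -> 0 <= s <= t -> U (x + r *: v + s *: u)) :
    exists r s, [/\ 0 <= r <= t, 0 <= s <= t &
      f (x + t *: v + t *: u) - f (x + t *: v) - f (x + t *: u) + f x =
      B (x + r *: v + s *: u) * t ^+ 2].
  exact: second_difference oU Cf t0 Ut.
(* The rest of the argument is about arbitrary [A] and [B], continuous at [x],
   that satisfy [sdA] and [sdB]. *)
move: A B sdA sdB cA cB {cont Cf} => A B sdA sdB cA cB.
suff AB (e : R) : 0 < e -> `|A x - B x| < e.
  apply/eqP; rewrite -subr_eq0; apply: contraT; rewrite -normr_gt0 => /AB.
  by rewrite ltxx.
move=> e0.
have e2 : 0 < e / 2 by rewrite divr_gt0.
have /nbhs_ballP[d /= d0 near_x] : nbhs x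
    [set y | [/\ U y, `|A x - A y| < e / 2 & `|B x - B y| < e / 2]].
  have nU : nbhs x U by exact: open_nbhs_nbhs.
  move/cvgrPdist_lt : cA => /(_ _ e2) cA.
  move/cvgrPdist_lt : cB => /(_ _ e2) cB.
  by apply: filterS3 nU cA cB => y.
(* This [t] keeps the whole parallelogram in the ball of radius [d]; the
   summand 1 allows [u] and [v] to vanish. *)
pose t := d / (`|u| + `|v| + 1).
have n0 : 0 < `|u| + `|v| + 1 by rewrite ltr_wpDl// addr_ge0.
have t0 : 0 < t by rewrite divr_gt0.
have close r s : 0 <= r <= t -> 0 <= s <= t -> ball x d (x + r *: u + s *: v).
  move=> /andP[r0 rt] /andP[s0 st].
  rewrite -ball_normE /ball_/= -addrA opprD addNKr normrN.
  apply: (le_lt_trans (ler_normD _ _)); rewrite !normrZ !ger0_norm//.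
  apply: (@le_lt_trans _ _ (t * (`|u| + `|v|))).
    by rewrite mulrDr lerD// ler_wpM2r.
  by rewrite mulrAC ltr_pdivrMr// ltr_pM2l// ltrDl.
have [r [s [rt st Ers]]] := sdA t (ltW t0)
  (fun r s rt st => let: And3 Uy _ _ := near_x _ (close r s rt st) in Uy).
have close' p q : 0 <= p <= t -> 0 <= q <= t -> ball x d (x + p *: v + q *: u).
  by move=> pt qt; rewrite addrAC; exact: close.
have [r' [s' [rt' st' Ers']]] := sdB t (ltW t0)
  (fun r s rt st => let: And3 Uy _ _ := near_x _ (close' r s rt st) in Uy).
have AB : A (x + r *: u + s *: v) = B (x + r' *: v + s' *: u).
  apply: (mulIf (x := t ^+ 2)); first by rewrite sqrf_eq0 gt_eqF.
  by rewrite -Ers -Ers' [x + t *: v + _]addrAC [_ - f (x + t *: v) - _]addrAC.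
have [_ Ax _] := near_x _ (close _ _ rt st).
have [_ _] := near_x _ (close' _ _ rt' st'); rewrite -AB => Bx.
rewrite -(subrKA (A (x + r *: u + s *: v))) (le_lt_trans (ler_normD _ _))//.
by rewrite [e]splitr ltrD// distrC.
Qed.

End Schwarz.

(** * Smooth matrix-valued maps and partial derivatives *)

Section SmoothOn.
Context (R : realType) (V : normedModType R).
Implicit Types (W : normedModType R) (U : set V).

Lemma smooth_on_ext W U (f g : V -> W) : open U ->
  (forall x, U x -> f x = g x) -> smooth_on U f -> smooth_on U g.
Proof. by move=> oU fg sf k; exact: Ck_on_ext fg (sf k). Qed.

Lemma smooth_on_differentiable W U (f : V -> W) x :
  smooth_on U f -> U x -> differentiable f x.
Proof. by move=> /(_ 1%N)[+ _]; exact. Qed.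

Lemma smooth_on_derive W U (f : V -> W) v :
  smooth_on U f -> smooth_on U (fun x => 'D_v f x).
Proof. by move=> sf k; have [_] := sf k.+1; exact. Qed.

Lemma smooth_on_cst W U (w : W) : smooth_on U (cst w).
Proof. by move=> k; exact: Ck_on_cst. Qed.

Lemma smooth_onD W U (f g : V -> W) : open U ->
  smooth_on U f -> smooth_on U g -> smooth_on U (fun x => f x + g x).
Proof. by move=> oU sf sg k; exact: Ck_onD. Qed.

Lemma smooth_on_linear W W' U (L : {linear W -> W'}) (f : V -> W) : open U ->
  continuous L -> smooth_on U f -> smooth_on U (fun x => L (f x)).
Proof. by move=> oU cL sf k; exact: Ck_on_linear. Qed.

Lemma smooth_onM U (f g : V -> R^o) : open U ->
  smooth_on U f -> smooth_on U g -> smooth_on U (fun x => f x * g x : R^o).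
Proof. by move=> oU sf sg k; exact: Ck_onM. Qed.

Lemma smooth_onN W U (f : V -> W) : open U ->
  smooth_on U f -> smooth_on U (fun x => - f x).
Proof.
move=> oU; apply: (smooth_on_linear (L := -%R)) => //.
exact: opp_continuous.
Qed.

Lemma smooth_onB W U (f g : V -> W) : open U ->
  smooth_on U f -> smooth_on U g -> smooth_on U (fun x => f x - g x).
Proof. by move=> oU sf sg; apply: smooth_onD => //; exact: smooth_onN. Qed.

Lemma smooth_on_sum W U n (f : 'I_n -> V -> W) : open U ->
  (forall i, smooth_on U (f i)) -> smooth_on U (fun x => \sum_(i < n) f i x).
Proof.
move=> oU; elim: n f => [|n IH] f sf.
  apply: (smooth_on_ext oU _ (smooth_on_cst U 0)) => x _.
  by rewrite big_ord0.
apply: (smooth_on_ext oU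
    (f := fun x => f ord0 x + \sum_(i < n) f (lift ord0 i) x)).
  by move=> x _; rewrite big_ord_recl.
by apply: smooth_onD => //; apply: IH.
Qed.

(** Smoothness is checked entrywise: entries are continuous linear functions
    of a matrix, and a matrix is a finite sum of entries times constant
    matrices. *)
Lemma smooth_on_mxP m n U (F : V -> 'M[R]_(m, n)) : open U ->
  smooth_on U F <-> forall i j, smooth_on U (fun x => F x i j : R^o).
Proof.
move=> oU; split=> [sF i j|sF].
  pose coordinate (N : 'M[R]_(m, n)) : R^o := N i j.
  have lin : linear coordinate by move=> a A B; rewrite /coordinate !mxE.
  pose L : {linear 'M[R]_(m, n) -> R^o} :=
    HB.pack coordinate (GRing.isLinear.Build _ _ _ _ _ lin).
  by apply: (smooth_on_linear (L := L)) => //; exact: coord_continuous.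
pose G i j x := F x i j *: (delta_mx i j : 'M[R]_(m, n)).
apply: (smooth_on_ext oU (f := fun x => \sum_i \sum_j G i j x)).
  by move=> x _; rewrite [RHS]matrix_sum_delta.
apply: smooth_on_sum => // i; apply: smooth_on_sum => // j.
have lin : linear (fun a : R^o => a *: (delta_mx i j : 'M[R]_(m, n))).
  by move=> a b c; rewrite scalerDl scalerA.
pose L : {linear R^o -> 'M[R]_(m, n)} :=
  HB.pack (fun a : R^o => a *: (delta_mx i j : 'M[R]_(m, n)))
    (GRing.isLinear.Build _ _ _ _ _ lin).
apply: (smooth_on_linear (L := L) oU _ (sF i j)).
exact: scalel_continuous.
Qed.

Lemma smooth_on_mulmx m n p U (F : V -> 'M[R]_(m, n)) (G : V -> 'M[R]_(n, p)) :
  open U -> smooth_on U F -> smooth_on U G -> smooth_on U (fun x => F x *m G x).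
Proof.
move=> oU /smooth_on_mxP sF /smooth_on_mxP sG; apply/smooth_on_mxP => // i j.
apply: (smooth_on_ext oU (f := fun x => \sum_k (F x i k * G x k j) : R^o)).
  by move=> x _; rewrite mxE.
apply: smooth_on_sum => // k; apply: smooth_onM => //; [exact: sF|exact: sG].
Qed.

Lemma smooth_on_trmx m n U (F : V -> 'M[R]_(m, n)) :
  open U -> smooth_on U F -> smooth_on U (fun x => (F x)^T).
Proof.
move=> oU /smooth_on_mxP sF; apply/smooth_on_mxP => // i j.
by apply: (smooth_on_ext oU _ (sF oU j i)) => x _; rewrite mxE.
Qed.

Lemma smooth_on_scale m n U (f : V -> R^o) (F : V -> 'M[R]_(m, n)) :
  open U -> smooth_on U f -> smooth_on U F ->
  smooth_on U (fun x => (f x : R) *: F x).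
Proof.
move=> oU sf /smooth_on_mxP sF; apply/smooth_on_mxP => // i j.
apply: (smooth_on_ext oU (f := fun x => f x * F x i j : R^o)).
  by move=> x _; rewrite mxE.
exact: smooth_onM (sF oU i j).
Qed.

End SmoothOn.

Section Partial.
Context (R : realType) (n : nat).
Implicit Types (x : 'rV[R]_n) (U : set 'rV[R]_n).

Lemma smooth_on_partial U (f : 'rV[R]_n -> R) i :
  smooth_on U (f : _ -> R^o) -> smooth_on U (partial f i : _ -> R^o).
Proof. exact: smooth_on_derive. Qed.

Lemma partial_ext U (f g : 'rV[R]_n -> R) i x : open U -> U x ->
  (forall y, U y -> f y = g y) -> partial f i x = partial g i x.
Proof. exact: derive_open_ext. Qed.

Lemma partial_comm U (f : 'rV[R]_n -> R) i j x : open U -> U x ->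
  smooth_on U (f : _ -> R^o) ->
  partial (partial f i) j x = partial (partial f j) i x.
Proof. by move=> oU Ux sf; exact: (derive_comm _ _ oU (sf 2%N) Ux). Qed.

Lemma partialM (f g : 'rV[R]_n -> R) i x :
  differentiable (f : _ -> R^o) x -> differentiable (g : _ -> R^o) x ->
  partial (fun y => f y * g y) i x =
  f x * partial g i x + partial f i x * g x.
Proof.
move=> df dg.
have dfi := diff_derivable (v := delta_mx 0 i) df.
have dgi := diff_derivable (v := delta_mx 0 i) dg.
by apply: etrans (deriveM dfi dgi) _; congr (_ + _); exact: mulrC.
Qed.

Lemma partial_sum p (f : 'I_p -> 'rV[R]_n -> R) i x :
  (forall k, differentiable (f k : _ -> R^o) x) ->
  partial (fun y => \sum_(k < p) f k y) i x = \sum_(k < p) partial (f k) i x.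
Proof.
move=> df; rewrite /partial -derive_sum; last first.
  by move=> k; exact: diff_derivable.
by congr ('D_ _ _ x); apply/funext => y; rewrite fct_sumE.
Qed.

Lemma derive_partial (f : 'rV[R]_n -> R) (v x : 'rV[R]_n) :
  differentiable (f : _ -> R^o) x ->
  'D_v (f : _ -> R^o) x = \sum_(l < n) v 0 l * partial f l x.
Proof.
move=> df; rewrite deriveE // {1}(row_sum_delta v) linear_sum.
by apply: eq_bigr => l _; rewrite linearZ /partial deriveE.
Qed.

Lemma derive_coord (F : 'rV[R]_n -> 'rV[R]_n) (v x : 'rV[R]_n) j :
  differentiable F x ->
  ('D_v F x) 0 j = 'D_v (fun y => F y 0 j : R^o) x.
Proof. by move=> dF; rewrite derive_mx ?mxE//; exact: diff_derivable. Qed.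

Lemma jacobianE (F : 'rV[R]_n -> 'rV[R]_n) x i j :
  differentiable F x -> jacobian F x i j = partial (fun y => F y 0 j) i x.
Proof. by move=> dF; rewrite mxE -deriveE// derive_coord. Qed.

Lemma partial_comp (f : 'rV[R]_n -> R) (F : 'rV[R]_n -> 'rV[R]_n) i x :
  differentiable F x -> differentiable (f : _ -> R^o) (F x) ->
  partial (fun y => f (F y)) i x =
  \sum_(m < n) jacobian F x i m * partial f m (F x).
Proof.
move=> dF df; have dc := differentiable_comp dF df.
rewrite /partial (deriveE _ dc) (diff_comp dF df)/= -(deriveE _ df).
rewrite derive_partial//; apply: eq_bigr => m _; congr (_ * _).
by rewrite mxE.
Qed.

End Partial.

(** * Charts and tensor fields *)

Section Charts.
Context (R : realType) (n : nat) (M : smooth_manifold R n).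
Implicit Types c d : atlas M.
Implicit Types x : 'rV[R]_n.

Lemma overlapE c d :
  overlap c d = chart_img c `&` param c @^-1` (chart_dom d).
Proof.
apply/seteqP; split=> x.
  by move=> [p [cp dp] <-]; split; [exists p|rewrite /preimage/= coordK].
by move=> [[p cp <-]]; rewrite /preimage/= coordK// => dp; exists p.
Qed.

Lemma img_open c : open (chart_img c).
Proof. exact: chart_img_open. Qed.

Lemma open_overlap c d : open (overlap c d).
Proof.
rewrite overlapE open_setSI; last exact: img_open.
have /continuousP := @param_continuous _ _ M c; apply.
exact: chart_dom_open.
Qed.

Lemma transition_img c d x : overlap c d x -> chart_img d (transition c d x).
Proof. by rewrite overlapE => -[_ dx]; exists (param c x). Qed.

Lemma param_transition c d x : overlap c d x ->
  param d (transition c d x) = param c x.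
Proof. by rewrite overlapE => -[_ dx]; rewrite coordK. Qed.

Lemma transition_differentiable c d x : overlap c d x ->
  differentiable (transition c d) x.
Proof. exact: smooth_on_differentiable (transition_smooth c d). Qed.

End Charts.

Arguments img_open {R n M} c.
Arguments open_overlap {R n M} c d.

Section TensorFields.
Context (R : realType) (n : nat) (M : smooth_manifold R n).
Implicit Types (f : local_field M R) (X Y : local_field M 'rV[R]_n).
Implicit Types (xi eta : local_field M 'cV[R]_n) (pi : local_field M 'M[R]_n).

Definition scalar_field f : Prop :=
  (forall c, smooth_on (chart_img c) (f c : _ -> R^o)) /\
  (forall c d x, overlap c d x -> f d (transition c d x) = f c x).

(** The matrix of [omega] has entries [omega (d_l, d_k)]; two-forms are the case
    of antisymmetric matrices. *)
Definition covariant_two_tensor (omega : local_field M 'M[R]_n) : Prop :=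
  (forall c, smooth_on (chart_img c) (omega c)) /\
  (forall c d x, overlap c d x ->
     omega c x = jacobian (transition c d) x *m omega d (transition c d x) *m
                 (jacobian (transition c d) x)^T).

Definition differential f : local_field M 'cV[R]_n :=
  fun c x => \col_k partial (f c) k x.

Definition exterior_derivative xi : local_field M 'M[R]_n :=
  fun c x => \matrix_(l, k) (partial (fun y => xi c y k 0) l x -
                             partial (fun y => xi c y l 0) k x).

Definition interior_product X (omega : local_field M 'M[R]_n) :
    local_field M 'cV[R]_n :=
  fun c x => (X c x *m omega c x)^T.

Lemma scalar_field_function (phi : M -> R) : smooth_function phi ->
  scalar_field (fun c x => phi (param c x)).
Proof. by move=> sphi; split=> // c d x /param_transition ->. Qed.

Lemma vector_field_sharp pi xi : bivector_field pi -> one_form xi ->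
  vector_field (sharp pi xi).
Proof.
move=> [spi _ tpi] [sxi txi]; split=> [c|c d x cdx].
  have sxiT := smooth_on_trmx (img_open c) (sxi c).
  exact: smooth_on_mulmx (img_open c) sxiT (spi c).
by rewrite /sharp tpi// (txi _ _ _ cdx) trmx_mul !mulmxA.
Qed.

Lemma scalar_field_pairing X xi : vector_field X -> one_form xi ->
  scalar_field (pairing1 X xi).
Proof.
move=> [sX tX] [sxi txi]; split=> [c|c d x cdx].
  have sXxi := smooth_on_mulmx (img_open c) (sX c) (sxi c).
  exact: (smooth_on_mxP _ (img_open c)).1 sXxi 0 0.
by rewrite /pairing1 tX// (txi _ _ _ cdx) mulmxA.
Qed.

Lemma one_formZ f xi : scalar_field f -> one_form xi ->
  one_form (fun c x => f c x *: xi c x).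
Proof.
move=> [sf tf] [sxi txi]; split=> [c|c d x cdx].
  exact: smooth_on_scale (img_open c) (sf c) (sxi c).
by rewrite tf// (txi _ _ _ cdx) scalemxAr.
Qed.

Lemma one_formD xi eta : one_form xi -> one_form eta ->
  one_form (fun c x => xi c x + eta c x).
Proof.
move=> [sxi txi] [seta teta]; split=> [c|c d x cdx].
  exact: smooth_onD (img_open c) (sxi c) (seta c).
by rewrite (txi _ _ _ cdx) (teta _ _ _ cdx) mulmxDr.
Qed.

Lemma one_formB xi eta : one_form xi -> one_form eta ->
  one_form (fun c x => xi c x - eta c x).
Proof.
move=> [sxi txi] [seta teta]; split=> [c|c d x cdx].
  exact: smooth_onB (img_open c) (sxi c) (seta c).
by rewrite (txi _ _ _ cdx) (teta _ _ _ cdx) mulmxBr.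
Qed.

Lemma one_form_differential f : scalar_field f -> one_form (differential f).
Proof.
move=> [sf tf]; split=> [c|c d x cdx].
  apply/(smooth_on_mxP _ (img_open c)) => k j.
  have sk := smooth_on_partial k (sf c).
  apply: (smooth_on_ext (img_open c) _ sk) => x _.
  by rewrite mxE.
have dt := transition_differentiable cdx.
have df := smooth_on_differentiable (sf d) (transition_img cdx).
apply/matrixP => k j; rewrite !mxE.
rewrite -(partial_ext _ (open_overlap c d) cdx (tf c d)) partial_comp//.
by apply: eq_bigr => m _; congr (_ * _); rewrite mxE.
Qed.

Lemma one_form_interior_product X omega :
  vector_field X -> covariant_two_tensor omega ->
  one_form (interior_product X omega).
Proof.
move=> [sX tX] [so to]; split=> [c|c d x cdx].
  have sXo := smooth_on_mulmx (img_open c) (sX c) (so c).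
  exact: smooth_on_trmx (img_open c) sXo.
by rewrite /interior_product tX// (to _ _ _ cdx) !trmx_mul trmxK !mulmxA.
Qed.

(** Differentiating [xi c y = J y *m xi d (tau y)], with [tau] the transition
    map and [J] its jacobian, produces the expected tensorial term and
    the second derivatives of [tau] contracted with [xi d].  The latter are
    symmetric, so antisymmetrization removes them. *)
Lemma covariant_two_tensor_exterior_derivative xi :
  one_form xi -> covariant_two_tensor (exterior_derivative xi).
Proof.
move=> [sxi txi].
have sxi1 c k : smooth_on (chart_img c) (fun y => xi c y k 0 : R^o).
  exact: (smooth_on_mxP _ (img_open c)).1 (sxi c) k 0.
split=> [c|c d x cdx].
  apply/(smooth_on_mxP _ (img_open c)) => l k.
  apply: (smooth_on_ext (img_open c) _ (smooth_onB (img_open c)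
    (smooth_on_partial l (sxi1 c k)) (smooth_on_partial k (sxi1 c l)))) => x _.
  by rewrite mxE.
have oW := open_overlap c d.
have dt y : overlap c d y -> differentiable (transition c d) y.
  exact: transition_differentiable.
pose tau k y : R := transition c d y 0 k.
have stau k : smooth_on (overlap c d) (tau k : _ -> R^o).
  exact: (smooth_on_mxP _ oW).1 (@transition_smooth _ _ M c d) 0 k.
pose J := jacobian (transition c d) x.
pose h m l k := partial (partial (tau m) k) l x.
pose a p m := partial (fun y => xi d y m 0) p (transition c d x).
have hC m l k : h m l k = h m k l by exact: partial_comm oW cdx (stau m).
have dxi m : differentiable (fun y => xi d y m 0 : R^o) (transition c d x).
  by apply: smooth_on_differentiable (sxi1 d m) (transition_img cdx).
have D l k : partial (fun y => xi c y k 0) l x =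
    \sum_m (J k m * \sum_p (J l p * a p m) +
            h m l k * xi d (transition c d x) m 0).
  have E y : overlap c d y -> xi c y k 0 =
      \sum_m (partial (tau m) k y * xi d (transition c d y) m 0).
    move=> cdy; rewrite (txi _ _ _ cdy) mxE.
    by apply: eq_bigr => m _; rewrite jacobianE//; exact: dt.
  have dJ m : differentiable (partial (tau m) k : _ -> R^o) x.
    by apply: smooth_on_differentiable cdx; exact: smooth_on_partial.
  have dc m : differentiable (fun y => xi d (transition c d y) m 0 : R^o) x.
    exact: (differentiable_comp (dt x cdx) (dxi m)).
  rewrite (partial_ext _ oW cdx E) partial_sum; last first.
    by move=> m; apply: differentiableM.
  apply: eq_bigr => m _; rewrite partialM//; congr (_ * _ + _).
    by rewrite /J jacobianE//; exact: dt.
  by rewrite (partial_comp l (dt x cdx) (dxi m)).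
have domega p m :
    exterior_derivative xi d (transition c d x) p m = a p m - a m p.
  by rewrite mxE.
rewrite -/J; apply/matrixP => l k; rewrite [LHS]mxE (D l k) (D k l).
move: J h a hC domega {D} => J h a hC domega; rewrite !big_split/=.
(* The terms with [h] cancel; what follows reindexes the other ones. *)
under [X in _ + X - _]eq_bigr do rewrite hC.
rewrite opprD addrACA subrr addr0.
rewrite [X in X - _](eq_bigr (fun m => \sum_p J l p * a p m * J k m));
  last first.
  by move=> m _; rewrite mulr_sumr; apply: eq_bigr => p _; rewrite mulrC.
rewrite [X in _ - X](eq_bigr (fun p => \sum_m J l p * a m p * J k m));
  last first.
  move=> p _; rewrite mulr_sumr; apply: eq_bigr => m _.
  by rewrite -!mulrA; congr (_ * _); rewrite mulrC.
rewrite [X in _ - X]exchange_big/= -sumrB [RHS]mxE; apply: eq_bigr => m _.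
rewrite -sumrB [X in _ = X * _]mxE [X in _ = _ * X]mxE mulr_suml.
by apply: eq_bigr => p _; rewrite domega -mulrBl -mulrBr.
Qed.

End TensorFields.

(** * The Koszul bracket in coordinates *)

Section KoszulAlgebra.
Context (K : comPzRingType) (n : nat).
Variables (p : 'I_n -> 'I_n -> K) (dp : 'I_n -> 'I_n -> 'I_n -> K).
Variables (x y : 'I_n -> K) (dx dy : 'I_n -> 'I_n -> K).

Let u l := \sum_i x i * p i l.
Let v l := \sum_i y i * p i l.
Let du l a := \sum_i (x i * dp l i a + dx l i * p i a).
Let dv l a := \sum_i (y i * dp l i a + dy l i * p i a).

(** The coordinate identity behind [sharp_koszul_bracket], at a point:
    [p], [x], [y] are the values of the bivector and of two one-forms,
    [dp l], [dx l], [dy l] their [l]-th partial derivatives, [u], [v] the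
    values of the two vector fields and [du l], [dv l] the partial derivatives
    that the product rule gives.  By antisymmetry of [p] the derivatives of
    [x] and [y] match on both sides; what remains is the second hypothesis,
    the Jacobi identity, contracted with [x i * y j]. *)
Lemma koszul_algebra (a : 'I_n) :
  (forall i j, p i j = - p j i) ->
  (forall i j, \sum_l (p i l * dp l j a - p j l * dp l i a) =
               \sum_l p l a * dp l i j) ->
  \sum_l (u l * dv l a - v l * du l a) =
  \sum_k ((\sum_l u l * (dy l k - dy k l)) - (\sum_l v l * (dx l k - dx k l)) +
          \sum_j (u j * dy k j + du k j * y j)) * p k a.
Proof.
move=> pN jacobi.
have vN i : \sum_j p i j * y j = - v i.
  by rewrite -sumrN; apply: eq_bigr => j _; rewrite pN mulNr mulrC.
pose q k := \sum_i \sum_j x i * y j * dp k i j.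
have duy k : \sum_j du k j * y j = q k - \sum_l v l * dx k l.
  under eq_bigr do rewrite mulr_suml.
  rewrite exchange_big -sumrB; apply: eq_bigr => i _ /=.
  rewrite mulrC -mulrN -vN mulr_sumr -big_split; apply: eq_bigr => j _ /=.
  by ring.
(* The terms in [dy k l] cancel, as do those in [dx k l] by [duy]. *)
transitivity (\sum_k (\sum_l u l * dy l k - \sum_l v l * dx l k + q k) *
                     p k a); last first.
  apply: eq_bigr => k _; congr (_ * _).
  rewrite big_split/= duy.
  under [in RHS]eq_bigr do rewrite mulrBr.
  under [X in _ = _ - X + _]eq_bigr do rewrite mulrBr.
  by rewrite !sumrB; ring.
have expand w (z : 'I_n -> K) (dz : 'I_n -> 'I_n -> K) :
    \sum_l w l * (\sum_i (z i * dp l i a + dz l i * p i a)) =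
    \sum_l w l * (\sum_i z i * dp l i a) + \sum_k (\sum_l w l * dz l k) * p k a.
  under [X in _ = _ + X]eq_bigr do rewrite mulr_suml.
  rewrite [X in _ = _ + X]exchange_big -big_split; apply: eq_bigr => l _ /=.
  rewrite big_split mulrDr; congr (_ + _); rewrite mulr_sumr.
  by apply: eq_bigr => k _; rewrite mulrA.
under [RHS]eq_bigr do rewrite mulrDl mulrBl.
rewrite [LHS]sumrB [RHS]big_split/= sumrB !expand.
have swap (z w : 'I_n -> K) :
    \sum_l (\sum_i z i * p i l) * (\sum_j w j * dp l j a) =
    \sum_i \sum_j z i * w j * \sum_l p i l * dp l j a.
  under eq_bigr do rewrite mulr_suml.
  rewrite exchange_big; apply: eq_bigr => i _ /=.
  under eq_bigr do rewrite mulr_sumr.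
  rewrite exchange_big; apply: eq_bigr => j _ /=.
  by rewrite mulr_sumr; apply: eq_bigr => l _; ring.
suff -> : \sum_k q k * p k a =
    \sum_l u l * (\sum_i y i * dp l i a) - \sum_l v l * (\sum_i x i * dp l i a).
  by ring.
rewrite !swap [X in _ = _ - X]exchange_big -sumrB.
under eq_bigr do rewrite mulr_suml.
rewrite exchange_big; apply: eq_bigr => i _ /=.
under eq_bigr do rewrite mulr_suml.
rewrite exchange_big -sumrB; apply: eq_bigr => j _ /=.
rewrite [y j * _]mulrC -mulrBr -sumrB jacobi mulr_sumr.
by apply: eq_bigr => l _; ring.
Qed.

End KoszulAlgebra.

(** * Foliated bivector fields *)

Section Foliated.
Context (R : realType) (n : nat) (M : smooth_manifold R n).
Implicit Types (f : local_field M R) (X Y A B : local_field M 'rV[R]_n).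
Implicit Types (xi eta : local_field M 'cV[R]_n) (pi : local_field M 'M[R]_n).

Lemma lie_bracket_ext X X' Y Y' : field_eq X X' -> field_eq Y Y' ->
  field_eq (lie_bracket X Y) (lie_bracket X' Y').
Proof.
move=> XX YY c x cx; rewrite /lie_bracket (XX c x cx) (YY c x cx).
congr (_ - _); apply: derive_open_ext (img_open c) cx _; [exact: YY|exact: XX].
Qed.

Lemma eq_sharp_image pi pi' : field_eq pi pi' ->
  sharp_image pi = sharp_image pi'.
Proof.
move=> E; apply/seteqP; split=> X [xi oxi Xxi]; exists xi => // c x cx;
  by rewrite Xxi// /sharp E.
Qed.

Lemma foliated_ext pi pi' : bivector_field pi -> field_eq pi pi' ->
  foliated pi' -> foliated pi.
Proof.
by move=> bpi E [_ fpi]; split=> //; rewrite (eq_sharp_image E).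
Qed.

(** The derivative of [f B] along [f A] is [f (f D_A B + A(f) B)]: the direction
    contributes a factor [f] even to the term in which [f] is differentiated.
    Hence [f] factors out of the bracket, also at the zeros of [f]. *)
Lemma lie_bracket_scale f A B c x :
  scalar_field f -> vector_field A -> vector_field B -> chart_img c x ->
  lie_bracket (fun c x => f c x *: A c x) (fun c x => f c x *: B c x) c x =
  f c x *: (f c x *: lie_bracket A B c x +
    pairing1 A (differential f) c x *: B c x -
    pairing1 B (differential f) c x *: A c x).
Proof.
move=> [sf _] [sA _] [sB _] cx.
have df := smooth_on_differentiable (sf c) cx.
have dA := smooth_on_differentiable (sA c) cx.
have dB := smooth_on_differentiable (sB c) cx.
have dco (F : 'rV[R]_n -> 'rV[R]_n) (dF : differentiable F x) i :
    differentiable (fun y => F y 0 i : R^o) x.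
  exact: differentiable_comp dF (differentiable_coord _ 0 i).
have dfA : differentiable (fun y => f c y *: A c y) x.
  have sfA := smooth_on_scale (img_open c) (sf c) (sA c).
  exact: smooth_on_differentiable sfA cx.
have dfB : differentiable (fun y => f c y *: B c y) x.
  have sfB := smooth_on_scale (img_open c) (sf c) (sB c).
  exact: smooth_on_differentiable sfB cx.
have D (F : 'rV[R]_n -> 'rV[R]_n) (dF : differentiable F x) i l :
    partial (fun y => (f c y *: F y) 0 i) l x =
    f c x * partial (fun y => F y 0 i) l x + partial (f c) l x * F x 0 i.
  have -> : (fun y => (f c y *: F y) 0 i) = (fun y => f c y * F y 0 i).
    by apply/funext => y; rewrite mxE.
  by rewrite (partialM l df (dco F dF i)).
have pairE F : pairing1 F (differential f) c x =
    \sum_l F c x 0 l * partial (f c) l x.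
  by rewrite /pairing1 mxE; apply: eq_bigr => l _; rewrite [X in _ * X]mxE.
apply/rowP => i; transitivity (f c x * (f c x * lie_bracket A B c x 0 i +
    pairing1 A (differential f) c x * B c x 0 i -
    pairing1 B (differential f) c x * A c x 0 i)); last by rewrite !mxE.
rewrite !lie_bracketE// !pairE !mulr_suml mulr_sumr -big_split -sumrB mulr_sumr.
apply: eq_bigr => l _ /=; rewrite (D _ dA) (D _ dB) mxE [X in _ - X * _]mxE.
move: (partial (f c) l x) (partial (fun y => A c y 0 i) l x).
move: (partial (fun y => B c y 0 i) l x) (f c x) => a b e g.
by ring.
Qed.

Lemma bivector_fieldZ f pi : scalar_field f -> bivector_field pi ->
  bivector_field (fun c x => f c x *: pi c x).
Proof.
move=> [sf tf] [spi api tpi]; split=> [c|c x cx|c d x cdx].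
- exact: smooth_on_scale (img_open c) (sf c) (spi c).
- by rewrite linearZ /= api// scalerN.
- by rewrite tf// tpi// -scalemxAr -scalemxAl.
Qed.

Lemma foliatedZ f pi : scalar_field f -> foliated pi ->
  foliated (fun c x => f c x *: pi c x).
Proof.
move=> sf [bpi fpi]; split; first exact: bivector_fieldZ.
move=> X Y [xi oxi Xxi] [eta oeta Yeta].
pose A := sharp pi xi; pose B := sharp pi eta.
have vA : vector_field A by exact: vector_field_sharp.
have vB : vector_field B by exact: vector_field_sharp.
have [||zeta ozeta ABzeta] := fpi A B; [by exists xi|by exists eta|].
have odf := one_form_differential sf.
exists (fun c x => f c x *: zeta c x +
                   pairing1 A (differential f) c x *: eta c x -
                   pairing1 B (differential f) c x *: xi c x).
  apply: one_formB; first apply: one_formD.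
  - exact: one_formZ.
  - by apply: one_formZ => //; exact: scalar_field_pairing.
  - by apply: one_formZ => //; exact: scalar_field_pairing.
move=> c x cx.
have trE (u v w : 'cV[R]_n) (a b e : R) :
    (a *: u + b *: v - e *: w)^T = a *: u^T + b *: v^T - e *: w^T.
  by apply/matrixP => i j; rewrite !mxE.
rewrite (@lie_bracket_ext X (fun c x => f c x *: A c x)
                          Y (fun c x => f c x *: B c x))//.
- rewrite lie_bracket_scale// ABzeta// /sharp -scalemxAr; congr (_ *: _).
  by rewrite trE mulmxBl mulmxDl -!scalemxAl.
- by move=> d y dy; rewrite Xxi// /sharp -scalemxAr.
- by move=> d y dy; rewrite Yeta// /sharp -scalemxAr.
Qed.

(** Written with interior products and differentials, rather than Lie
    derivatives, so that each term is a one-form by itself. *)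
Definition koszul_bracket pi xi eta : local_field M 'cV[R]_n :=
  fun c x =>
    interior_product (sharp pi xi) (exterior_derivative eta) c x -
    interior_product (sharp pi eta) (exterior_derivative xi) c x +
    differential (pairing1 (sharp pi xi) eta) c x.

Lemma one_form_koszul_bracket pi xi eta : bivector_field pi ->
  one_form xi -> one_form eta -> one_form (koszul_bracket pi xi eta).
Proof.
move=> bpi oxi oeta; apply: one_formD; first apply: one_formB.
- apply: one_form_interior_product; first exact: vector_field_sharp.
  exact: covariant_two_tensor_exterior_derivative.
- apply: one_form_interior_product; first exact: vector_field_sharp.
  exact: covariant_two_tensor_exterior_derivative.
- apply: one_form_differential; apply: scalar_field_pairing => //.
  exact: vector_field_sharp.
Qed.

Lemma sharp_koszul_bracket pi xi eta : poisson pi ->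
  one_form xi -> one_form eta ->
  field_eq (lie_bracket (sharp pi xi) (sharp pi eta))
           (sharp pi (koszul_bracket pi xi eta)).
Proof.
move=> [bpi jacobi] oxi oeta c x cx.
have [spi api _] := bpi.
have dentry p q (F : 'rV[R]_n -> 'M[R]_(p, q)) i j :
    smooth_on (chart_img c) F -> differentiable (fun y => F y i j : R^o) x.
  move=> /(smooth_on_mxP _ (img_open c)) sF.
  exact: smooth_on_differentiable (sF i j) cx.
have dpi i j : differentiable (fun y => pi c y i j : R^o) x.
  exact: dentry.
have dform xi' i : one_form xi' ->
    differentiable (fun y => xi' c y i 0 : R^o) x.
  by move=> [sxi' _]; exact: dentry (sxi' c).
have [vxi veta] := (vector_field_sharp bpi oxi, vector_field_sharp bpi oeta).
have dxi := smooth_on_differentiable (vxi.1 c) cx.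
have deta := smooth_on_differentiable (veta.1 c) cx.
pose dp l i j := partial (fun y => pi c y i j) l x.
pose d1 (xi' : local_field M 'cV[R]_n) l i :=
  partial (fun y => xi' c y i 0) l x.
have sharpE xi' y l : sharp pi xi' c y 0 l = \sum_i xi' c y i 0 * pi c y i l.
  by rewrite mxE; apply: eq_bigr => i _; rewrite mxE.
have dsharp xi' l a : one_form xi' ->
    partial (fun y => sharp pi xi' c y 0 a) l x =
    \sum_i (xi' c x i 0 * dp l i a + d1 xi' l i * pi c x i a).
  move=> oxi'.
  transitivity (partial (fun y => \sum_i xi' c y i 0 * pi c y i a) l x).
    by congr (partial _ _ _); apply/funext => y; exact: sharpE.
  rewrite partial_sum; last first.
    by move=> i; exact: differentiableM (dform xi' i oxi') (dpi i a).
  by apply: eq_bigr => i _; rewrite partialM//; exact: dform.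
have dpair k : partial (pairing1 (sharp pi xi) eta c) k x =
    \sum_j (sharp pi xi c x 0 j * d1 eta k j +
            partial (fun y => sharp pi xi c y 0 j) k x * eta c x j 0).
  have dco i : differentiable (fun y => sharp pi xi c y 0 i : R^o) x.
    exact: differentiable_comp dxi (differentiable_coord _ 0 i).
  transitivity
    (partial (fun y => \sum_j sharp pi xi c y 0 j * eta c y j 0) k x).
    by congr (partial _ _ _); apply/funext => y; rewrite /pairing1 mxE.
  rewrite partial_sum; last first.
    by move=> j; exact: differentiableM (dco j) (dform eta j oeta).
  by apply: eq_bigr => j _; rewrite partialM//; exact: dform.
have pN y i j : chart_img c y -> pi c y i j = - pi c y j i.
  by move=> cy; have /matrixP/(_ j i) := api c y cy; rewrite !mxE.
have dpN l i j : dp l i j = - dp l j i.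
  rewrite /dp; have dd := diff_derivable (v := delta_mx 0 l) (dpi j i).
  have := deriveN dd; rewrite /partial => <-.
  by apply: derive_open_ext (img_open c) cx _ => y cy; exact: pN.
apply/rowP => a; rewrite lie_bracketE//.
transitivity (\sum_l
    ((\sum_i xi c x i 0 * pi c x i l) *
       (\sum_i (eta c x i 0 * dp l i a + d1 eta l i * pi c x i a)) -
     (\sum_i eta c x i 0 * pi c x i l) *
       (\sum_i (xi c x i 0 * dp l i a + d1 xi l i * pi c x i a)))).
  by apply: eq_bigr => l _; rewrite !sharpE (dsharp eta)// (dsharp xi).
rewrite koszul_algebra; last 2 first.
- by move=> i j; exact: pN.
- move=> i j.
  (* The cyclic sum of [S] is half of the bracket [[pi, pi]]. *)
  pose S e1 e2 e3 := \sum_l pi c x e1 l * dp l e2 e3.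
  have : S i j a *+ 2 + S j a i *+ 2 + S a i j *+ 2 = 0.
    rewrite -(congr1 (fun s => s i j a) (jacobi c x cx)) /schouten.
    by rewrite !big_split /= !mulr2n.
  rewrite -!mulrnDl => /eqP; rewrite mulrn_eq0/= addr_eq0 => /eqP SE.
  have -> : \sum_l pi c x l a * dp l i j = - S a i j.
    by rewrite -sumrN; apply: eq_bigr => l _; rewrite (pN x a l)// mulNr opprK.
  rewrite -SE -big_split; apply: eq_bigr => l _ /=.
  by rewrite (dpN l i a) mulrN opprK.
rewrite sharpE; apply: eq_bigr => k _; congr (_ * _).
rewrite /koszul_bracket /interior_product !mxE dpair; congr (_ - _ + _).
- by apply: eq_bigr => l _; rewrite sharpE mxE.
- by apply: eq_bigr => l _; rewrite sharpE mxE.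
- by apply: eq_bigr => l _; rewrite sharpE (dsharp xi).
Qed.

Lemma poisson_foliated pi : poisson pi -> foliated pi.
Proof.
move=> ppi; have [bpi _] := ppi; split=> // X Y [xi oxi Xxi] [eta oeta Yeta].
exists (koszul_bracket pi xi eta); first exact: one_form_koszul_bracket.
move=> c x cx; rewrite (lie_bracket_ext Xxi Yeta)//.
exact: sharp_koszul_bracket.
Qed.

End Foliated.

Theorem proposition6 (R : realType) (n : nat) (M : smooth_manifold R n) :
  (forall pi : local_field M 'M[R]_n, bivector_field pi -> foliated pi ->
     forall phi : M -> R, smooth_function phi ->
       foliated (scale_bivector phi pi)) /\
  (forall pi : local_field M 'M[R]_n, conformally_poisson pi -> foliated pi).
Proof.
split=> [pi _ fpi phi sphi|pi [bpi [phi [pi' [sphi ppi' E]]]]].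
  exact: foliatedZ (scalar_field_function sphi) fpi.
apply: foliated_ext bpi E _.
exact: foliatedZ (scalar_field_function sphi) (poisson_foliated ppi').
Qed.
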